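(* Each of the complete bipartite graphs $K_{1,24}$, $K_{2,12}$, $K_{3,9}$ and $K_{4,6}$ admits an empty-ply drawing.
   Context: A straight-line drawing of a graph places each vertex at a distinct point of the plane and draws each edge as the straight-line segment between its endpoints (edges are allowed to overlap). For each vertex $v$, the ply-disk $D_v$ is the open disk centered at $v$ with radius equal to half the length of the longest edge incident to $v$. A drawing is empty-ply if every ply-disk $D_v$ contains no vertex other than $v$ in its interior. *)

(* Defs.v *)
From HB Require Import structures.
From mathcomp Require Import all_boot all_order all_algebra.
From mathcomp Require Import classical_sets reals.

Set Implicit Arguments.
Unset Strict Implicit.
Unset Printing Implicit Defensive.

Import Order.TTheory GRing.Theory Num.Theory.
Local Open Scope classical_set_scope.
Local Open Scope ring_scope.

Record sgraph := SGraph {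
  vertex : finType;
  adj : rel vertex;
  adj_sym : symmetric adj;
  adj_irrefl : irreflexive adj
}.

Section CompleteBipartite.
Variables m n : nat.

Definition Kmn_adj : rel ('I_m + 'I_n)%type := fun x y =>
  match x, y with
  | inl _, inr _ | inr _, inl _ => true
  | _, _ => false
  end.

Lemma Kmn_adj_sym : symmetric Kmn_adj.
Proof. by move=> [?|?] [?|?]. Qed.

Lemma Kmn_adj_irrefl : irreflexive Kmn_adj.
Proof. by move=> [?|?]. Qed.

Definition Kmn : sgraph := SGraph Kmn_adj_sym Kmn_adj_irrefl.

End CompleteBipartite.

(* The norm that the library puts on R * R is the sup norm, so the Euclidean
   distance is defined by hand. *)
Definition eucl_dist (R : realType) (p q : R * R) : R :=
  Num.sqrt ((p.1 - q.1) ^+ 2 + (p.2 - q.2) ^+ 2).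

(* A straight-line drawing is determined by its vertex positions: each edge is
   the segment between the positions of its ends, and no condition is put on
   the segments, since edges may overlap. *)
Record drawing (R : realType) (G : sgraph) := Drawing {
  pos :> vertex G -> R * R;
  pos_inj : injective pos
}.

Section Ply.
Variables (R : realType) (G : sgraph) (D : drawing R G).

Definition edge_length (u v : vertex G) : R := eucl_dist (D u) (D v).

(* Lengths are nonnegative, so the default 0 of the iterated maximum only
   matters for an isolated vertex, whose ply-disk is then empty. *)
Definition longest_edge (v : vertex G) : R :=
  \big[Num.max/0]_(u : vertex G | adj v u) edge_length v u.

Definition ply_radius (v : vertex G) : R := longest_edge v / 2.

Definition ply_disk (v : vertex G) : set (R * R) :=
  [set x | eucl_dist (D v) x < ply_radius v].

Definition empty_ply : Prop :=
  forall u v : vertex G, u <> v -> ~ ply_disk v (D u).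

End Ply.

Definition admits_empty_ply (R : realType) (G : sgraph) : Prop :=
  exists D : drawing R G, empty_ply D.

(* Main.v *)
Require Import Defs.
From mathcomp Require Import all_boot all_order all_algebra.
From mathcomp Require Import reals.

(** The vertices are placed at points [(a, b * sqrt 3)] with [a] and [b]
    integers, so that squared distances are values of the form
    [a^2 + 3 b^2] and emptiness of all ply-disks is a finite integer
    computation.  For K_{2,12}, K_{3,9} and K_{4,6} the points are chosen in the
    triangular lattice [a = b mod 2], of minimal distance 2, such that
    every edge has length at most 4.  For K_{1,24} the leaves form
    two nearly regular 12-gons around the center, of radii close to 10 and 20,
    rotated by 15 degrees relative to each other: this works because the side
    [2 sin 15°] of the regular 12-gon in the unit circle exceeds 1/2. *)

Import Order.TTheory GRing.Theory Num.Theory.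
Local Open Scope ring_scope.

Definition sqdist3 (p q : int * int) : int :=
  (p.1 - q.1) ^+ 2 + 3 * (p.2 - q.2) ^+ 2.

Definition point3 (R : realType) (p : int * int) : R * R :=
  (p.1%:~R, p.2%:~R * Num.sqrt 3).

Lemma eucl_dist_point3 (R : realType) (p q : int * int) :
  eucl_dist (point3 R p) (point3 R q) = Num.sqrt (sqdist3 p q)%:~R.
Proof.
rewrite /eucl_dist /= -mulrBl exprMn sqr_sqrtr ?ler0n//.
by rewrite /sqdist3 rmorphD rmorphM !rmorphXn !rmorphB [_ * 3]mulrC.
Qed.

Lemma point3_inj (R : realType) : injective (point3 R).
Proof.
have sqrt3_neq0 : Num.sqrt 3 != 0 :> R by rewrite sqrtr_eq0 -ltNge ltr0n.
by move=> [a b] [c d] [/intr_inj -> /(mulIf sqrt3_neq0)/intr_inj ->].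
Qed.

(** Squaring [|vw| / 2 <= |vu|] gives the factor 4 and removes the square roots, leaving an integer
    inequality. *)
Lemma admits_empty_ply_point3 (R : realType) (G : sgraph)
    (p : vertex G -> int * int) :
    injective p ->
    (forall u v w, u <> v -> adj v w ->
       sqdist3 (p v) (p w) <= 4 * sqdist3 (p v) (p u)) ->
  admits_empty_ply R G.
Proof.
move=> p_inj p_ply; exists (Drawing (inj_comp (point3_inj R) p_inj)).
move=> u v uv; apply/negP; rewrite -leNgt ler_pdivrMr ?ltr0n//.
apply: bigmax_le => [|w vw]; first by rewrite mulr_ge0 ?sqrtr_ge0 ?ler0n.
rewrite /edge_length /= !eucl_dist_point3.
have -> : 2 = Num.sqrt (2 ^+ 2) :> R by rewrite sqrtr_sqr ger0_norm ?ler0n.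
rewrite mulrC -sqrtrM ?exprn_ge0 ?ler0n// ler_wsqrtr//.
by rewrite -natrX -[_%:R]/(4%:~R) -intrM ler_int p_ply.
Qed.

(** Every pair in [A] times [B] is an edge, so no adjacency test occurs; [S] is meant to list all
    the vertices. *)
Definition side_ply_ok (A B S : seq (int * int)) : bool :=
  all (fun v => all (fun w => all (fun u =>
    (u == v) || (sqdist3 v w <= 4 * sqdist3 v u)) S) B) A.

Definition Kmn_ply_ok (A B : seq (int * int)) : bool :=
  [&& uniq (A ++ B), side_ply_ok A B (A ++ B) & side_ply_ok B A (A ++ B)].

Lemma side_ply_okP {A B S : seq (int * int)} {u v w : int * int} :
    side_ply_ok A B S -> v \in A -> w \in B -> u \in S -> u <> v ->
  sqdist3 v w <= 4 * sqdist3 v u.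
Proof.
move=> ok vA wB uS /eqP/negPf uv.
by have := allP (allP (allP ok v vA) w wB) u uS; rewrite uv.
Qed.

Lemma Kmn_admits_empty_ply (R : realType) (A B : seq (int * int)) :
  Kmn_ply_ok A B -> admits_empty_ply R (Kmn (size A) (size B)).
Proof.
move=> /and3P[uniqAB okA okB].
pose p (x : 'I_(size A) + 'I_(size B)) : int * int :=
  match x with inl i => nth 0 A i | inr j => nth 0 B j end.
have pAB x : p x \in A ++ B.
  by case: x => i; rewrite mem_cat /= mem_nth ?orbT.
have p_inj : injective p.
  move: uniqAB; rewrite cat_uniq => /and3P[uniqA /hasPn disjAB uniqB].
  move=> [i|i] [j|j] /= /eqP.
  - by rewrite nth_uniq// => /eqP/val_inj ->.
  - move=> /eqP eq_ij; have := disjAB _ (mem_nth 0 (ltn_ord j)).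
    by rewrite -eq_ij mem_nth.
  - move=> /eqP eq_ij; have := disjAB _ (mem_nth 0 (ltn_ord i)).
    by rewrite eq_ij mem_nth.
  - by rewrite nth_uniq// => /eqP/val_inj ->.
apply: (@admits_empty_ply_point3 R (Kmn _ _) p) => // u v w uv.
have puv : p u <> p v by move/p_inj.
case: v w uv puv => [i|i] [j|j] //= _ puv _.
- by apply: (side_ply_okP okA _ _ (pAB u) puv); rewrite mem_nth.
- by apply: (side_ply_okP okB _ _ (pAB u) puv); rewrite mem_nth.
Qed.

Theorem theorem5 (R : realType) :
  [/\ admits_empty_ply R (Kmn 1 24),
      admits_empty_ply R (Kmn 2 12),
      admits_empty_ply R (Kmn 3 9) &
      admits_empty_ply R (Kmn 4 6)].
Proof.
split.
(* Squared norms are 100 or 108 on the inner ring and 388 on the outer one; [388 <= 4 * 100] keeps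
   the disk of the center empty. *)
- apply: (@Kmn_admits_empty_ply R [:: (0, 0)]
    [:: (10, 0); (9, 3); (5, 5); (0, 6); (-5, 5); (-9, 3);
        (-10, 0); (-9, -3); (-5, -5); (0, -6); (5, -5); (9, -3);
        (19, 3); (14, 8); (5, 11); (-5, 11); (-14, 8); (-19, 3);
        (-19, -3); (-14, -8); (-5, -11); (5, -11); (14, -8); (19, -3)]).
  by vm_compute.
(* From here on, the second list holds all other lattice points within distance 4 of every point of
   the first. In this and the last case the lattice is translated to [a + b] odd. *)
- apply: (@Kmn_admits_empty_ply R [:: (-1, 0); (1, 0)]
    [:: (-3, 0); (3, 0); (-2, 1); (0, 1); (2, 1); (-2, -1); (0, -1); (2, -1);
        (-1, 2); (1, 2); (-1, -2); (1, -2)]).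
  by vm_compute.
- apply: (@Kmn_admits_empty_ply R [:: (0, 0); (-1, 1); (1, 1)]
    [:: (-1, -1); (1, -1); (-2, 0); (2, 0); (-3, 1); (3, 1);
        (-2, 2); (0, 2); (2, 2)]).
  by vm_compute.
- apply: (@Kmn_admits_empty_ply R [:: (-1, 0); (1, 0); (0, -1); (0, 1)]
    [:: (-3, 0); (3, 0); (-2, -1); (2, -1); (-2, 1); (2, 1)]).
  by vm_compute.
Qed.
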